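(* Let $w_1,w_2,w_3$ be positive integers, $n\ge0$ an integer, and $y\in\mathbb{Z}_p$. Then \begin{align*} &\sum_{k+l+m=n}\binom{n}{k,l,m}B_{k,q^{w_3}}(w_1y)B_{l,q^{w_1}}(w_2y)B_{m,q^{w_2}}(w_3y)\,w_3^kw_1^lw_2^m\\ &=\sum_{k+l+m=n}\binom{n}{k,l,m}B_{k,q^{w_2}}(w_1y)B_{l,q^{w_1}}(w_3y)B_{m,q^{w_3}}(w_2y)\,w_2^kw_1^lw_3^m. \end{align*}
   Context: Let $p$ be a prime, $\mathbb{C}_p$ the completion of an algebraic closure of $\mathbb{Q}_p$, and $|\cdot|_p$ the absolute value on $\mathbb{C}_p$ with $|p|_p=1/p$. Fix $q\in\mathbb{C}_p$ with $q\neq 1$ and $|q-1|_p<p^{-1/(p-1)}$; for every positive integer $w$, $Q=q^w$ also satisfies these conditions. For such $Q$, the $Q$-Bernoulli numbers are defined by $\frac{\log Q+t}{Qe^t-1}=\sum_{n\ge0}B_{n,Q}\frac{t^n}{n!}$ ($\log$ the $p$-adic logarithm), and the $Q$-Bernoulli polynomials by $\frac{\log Q+t}{Qe^t-1}e^{xt}=\sum_{n\ge0}B_{n,Q}(x)\frac{t^n}{n!}$, i.e. $B_{n,Q}(x)=\sum_{j=0}^n\binom{n}{j}B_{j,Q}x^{n-j}$. The sum $\sum_{k+l+m=n}$ runs over nonnegative integers $k,l,m$ with $k+l+m=n$, and $\binom{n}{k,l,m}=\frac{n!}{k!\,l!\,m!}$. *)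

(* Defs.v *)
From HB Require Import structures.
From mathcomp Require Import all_boot all_order all_algebra.
From mathcomp Require Import all_classical all_reals all_analysis.
From mathcomp Require Import ring.

Set Implicit Arguments.
Unset Strict Implicit.
Unset Printing Implicit Defensive.

Import Order.TTheory GRing.Theory Num.Theory.
Import numFieldNormedType.Exports.

Local Open Scope classical_set_scope.
Local Open Scope ring_scope.

Record is_absval (R : realType) (K : fieldType) (v : K -> R) : Prop := {
  absval_ge0 : forall x, 0 <= v x ;
  absval_eq0 : forall x, v x = 0 <-> x = 0 ;
  absvalM : forall x y, v (x * y) = v x * v y ;
  absvalD : forall x y, v (x + y) <= v x + v y
}.

Definition absval_cvg (R : realType) (K : fieldType) (v : K -> R)
    (u : nat -> K) (l : K) : Prop :=
  v (u n - l) @[n --> \oo] --> (0 : R).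

Definition absval_cauchy (R : realType) (K : fieldType) (v : K -> R)
    (u : nat -> K) : Prop :=
  forall e : R, 0 < e -> exists N : nat,
    forall m n : nat, (N <= m)%N -> (N <= n)%N -> v (u m - u n) < e.

Record is_completion (R : realType) (K L : fieldType) (vK : K -> R)
    (vL : L -> R) (i : {rmorphism K -> L}) : Prop := {
  completion_absval : is_absval vL ;
  completion_isometry : forall x, vL (i x) = vK x ;
  completion_complete : forall u : nat -> L,
    absval_cauchy vL u -> exists l, absval_cvg vL u l ;
  completion_dense : forall (x : L) (e : R), 0 < e ->
    exists y : K, vL (x - i y) < e
}.

Record is_algebraic_closure (K L : fieldType) (i : {rmorphism K -> L}) :
    Prop := {
  closure_closed : GRing.closed_field_axiom L ;
  closure_algebraic : forall x : L, algebraicOver i x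
}.

Definition rat_padic_abs (R : realType) (p : nat) (x : rat) : R :=
  if x == 0 then 0
  else p%:R ^+ logn p `|denq x|%N / p%:R ^+ logn p `|numq x|%N.

(* The fields Q_p, its algebraic closure and C_p are unique up to isometric
   isomorphism only; the record packages any choice of the tower
   Q -> Q_p -> Qpbar -> C_p.  The normalisation |p| = 1/p is that of
   rat_padic_abs, which all the absolute values extend. *)
Record padic_complex (R : realType) (p : nat) := {
  Qp : fieldType ;
  Qpbar : fieldType ;
  Cp : fieldType ;
  Qp_abs : Qp -> R ;
  Qpbar_abs : Qpbar -> R ;
  Cp_abs : Cp -> R ;
  rat_to_Qp : {rmorphism rat -> Qp} ;
  Qp_to_Qpbar : {rmorphism Qp -> Qpbar} ;
  Qpbar_to_Cp : {rmorphism Qpbar -> Cp} ;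
  Qp_completion : is_completion (@rat_padic_abs R p) Qp_abs rat_to_Qp ;
  Qpbar_closure : is_algebraic_closure Qp_to_Qpbar ;
  Qpbar_absval : is_absval Qpbar_abs ;
  Qpbar_abs_ext : forall x, Qpbar_abs (Qp_to_Qpbar x) = Qp_abs x ;
  Cp_completion : is_completion Qpbar_abs Cp_abs Qpbar_to_Cp
}.

Definition padic_int (R : realType) (p : nat) (F : padic_complex R p) : set (Cp F) :=
  [set Qpbar_to_Cp F (Qp_to_Qpbar F y) | y in [set y : Qp F | Qp_abs y <= 1]].

(* log x = \sum_(n >= 1) (-1)^(n+1) (x-1)^n / n; meaningful for |x - 1| < 1,
   with junk value 0 where the series diverges. *)
Definition padic_log (R : realType) (p : nat) (F : padic_complex R p)
    (x : Cp F) : Cp F :=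
  xget 0 [set l | absval_cvg (@Cp_abs R p F)
    (fun N => \sum_(1 <= n < N) (-1) ^+ n.+1 * (x - 1) ^+ n / n%:R) l].

(* A formal power series is the sequence of its coefficients. *)
Section FormalSeries.
Variable K : fieldType.
Implicit Types a b : nat -> K.

Definition fps_mul a b : nat -> K :=
  fun n => \sum_(i < n.+1) a i * b (n - i)%N.

(* fps_inv_rev a n lists the coefficients n-1, ..., 0 of 1/a. *)
Fixpoint fps_inv_rev a (n : nat) : seq K :=
  if n is m.+1 then
    let s := fps_inv_rev a m in
    (a 0%N)^-1 * ((m == 0%N)%:R - \sum_(i < m) a i.+1 * s`_i) :: s
  else [::].

Definition fps_inv a : nat -> K := fun n => (fps_inv_rev a n.+1)`_0.

Definition fps_exp (x : K) : nat -> K := fun n => x ^+ n / n`!%:R.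

Lemma nth_fps_inv_rev a n i : (i < n)%N ->
  (fps_inv_rev a n)`_i = fps_inv a (n - i.+1)%N.
Proof.
elim: n i => [|n IHn] [|i] //; first by rewrite subn1.
by rewrite ltnS => lt_in; rewrite subSS -IHn.
Qed.

Lemma fps_mulV a : a 0%N != 0 ->
  fps_mul a (fps_inv a) = fun n => (n == 0%N)%:R.
Proof.
move=> a0; apply/funext => n; rewrite /fps_mul big_ord_recl subn0.
rewrite {1}/fps_inv /= mulVKf // -addrA [X in _ + X](_ : _ = 0) ?addr0 //.
apply/eqP; rewrite addrC subr_eq0; apply/eqP/eq_bigr => i _.
by rewrite nth_fps_inv_rev.
Qed.

End FormalSeries.

Section QBernoulli.
Variables (R : realType) (p : nat) (F : padic_complex R p).
Implicit Types Q x : Cp F.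

(* (log Q + t) / (Q e^t - 1) as a power series in t. *)
Definition qbernoulli_gf Q : nat -> Cp F :=
  fps_mul
    (fun n => padic_log Q *+ (n == 0%N) + (n == 1%N)%:R)
    (fps_inv (fun n => Q * fps_exp 1 n - (n == 0%N)%:R)).

Definition qbernoulli_number (n : nat) Q : Cp F :=
  n`!%:R * qbernoulli_gf Q n.

Definition qbernoulli (n : nat) Q x : Cp F :=
  n`!%:R * fps_mul (qbernoulli_gf Q) (fps_exp x) n.

Lemma Cp_natr_neq0 (n : nat) : (0 < n)%N -> n%:R != 0 :> Cp F.
Proof.
rewrite lt0n -(rmorph_nat (Qpbar_to_Cp F)) -(rmorph_nat (Qp_to_Qpbar F)).
by rewrite -(rmorph_nat (rat_to_Qp F)) !fmorph_eq0 pnatr_eq0.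
Qed.

Lemma qbernoulliE n Q x :
  qbernoulli n Q x =
  \sum_(j < n.+1) 'C(n, j)%:R * qbernoulli_number j Q * x ^+ (n - j).
Proof.
rewrite /qbernoulli /fps_mul mulr_sumr; apply: eq_bigr => j _.
have le_jn : (j <= n)%N by rewrite -ltnS.
rewrite /qbernoulli_number /fps_exp -(bin_fact le_jn) !natrM.
by field; rewrite !Cp_natr_neq0 ?fact_gt0.
Qed.

End QBernoulli.

Definition trinomial (n k l m : nat) : nat := n`! %/ (k`! * l`! * m`!).

(* Main.v *)
(* The factor B_{k,Q}(x) w^k is k! times the t^k-coefficient of
   G_Q(w t) e^{w x t}, where G_Q is the generating series of the Q-Bernoulli
   numbers.  Hence both sides are n! times the t^n-coefficient of the product
   of the series G_{q^{w_i}}(w_i t) (i = 1, 2, 3) and e^{w_i w_j y t} (i < j);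
   only the way the exponentials are paired with the G's differs. *)

Require Import Defs.
From HB Require Import structures.
From mathcomp Require Import all_boot all_order all_algebra.
From mathcomp Require Import all_classical all_reals all_analysis.
From mathcomp Require Import ring.

Set Implicit Arguments.
Unset Strict Implicit.
Unset Printing Implicit Defensive.

Import Order.TTheory GRing.Theory Num.Theory.

Local Open Scope ring_scope.

Section FormalSeriesProduct.
Variable K : fieldType.
Implicit Types a b c : nat -> K.

(** The coefficient of index [n] only sees entries of index at most [n], so truncating at [N] is
    harmless. This lets the ring laws of [{poly K}] pass to [fps_mul]. *)
Lemma fps_mul_coef_poly a b N n : (n < N)%N ->
  fps_mul a b n = ((\poly_(i < N) a i) * (\poly_(i < N) b i))`_n.
Proof.
move=> ltnN; rewrite coefM; apply: eq_bigr => i _.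
have le_in : (i <= n)%N by rewrite -ltnS.
by rewrite !coef_poly (leq_ltn_trans le_in) // (leq_ltn_trans (leq_subr _ _)).
Qed.

Lemma fps_mulC a b : fps_mul a b = fps_mul b a.
Proof.
by apply/funext => n; rewrite !(@fps_mul_coef_poly _ _ n.+1) // mulrC.
Qed.

Lemma fps_mulA a b c :
  fps_mul a (fps_mul b c) = fps_mul (fps_mul a b) c.
Proof.
apply/funext => n.
pose T d := \poly_(i < n.+1) d i : {poly K}.
transitivity ((T a * (T b * T c))`_n).
  rewrite coefM; apply: eq_bigr => i _; rewrite coef_poly ltn_ord.
  by rewrite (@fps_mul_coef_poly _ _ n.+1) // ltnS leq_subr.
rewrite mulrA coefM; apply: eq_bigr => i _.
by rewrite coef_poly ltnS leq_subr (@fps_mul_coef_poly _ _ n.+1).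
Qed.

(** The substitution of [w * t] for [t] is multiplicative, since [w ^+ n] splits along each pair of
    indices of sum [n]. *)
Lemma fps_mul_scale (w : K) a b n :
  fps_mul a b n * w ^+ n =
  fps_mul (fun i => a i * w ^+ i) (fun i => b i * w ^+ i) n.
Proof.
rewrite /fps_mul mulr_suml; apply: eq_bigr => i _.
have le_in : (i <= n)%N by rewrite -ltnS.
by rewrite mulrACA -exprD subnKC.
Qed.

Lemma fps_exp_scale (w x : K) n : fps_exp x n * w ^+ n = fps_exp (w * x) n.
Proof. by rewrite /fps_exp exprMn mulrAC [_ * w ^+ n]mulrC. Qed.

Lemma sum_trinomial_fps_mul a b c n :
  \sum_(k < n.+1) \sum_(l < n.+1) \sum_(m < n.+1 | (k + l + m)%N == n)
    a k * b l * c m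
  = fps_mul a (fps_mul b c) n.
Proof.
apply: eq_bigr => k _; have le_kn : (k <= n)%N by rewrite -ltnS.
rewrite /fps_mul mulr_sumr.
(* The range [l <= n - k] of the convolution is widened to [l <= n] under a guard, to match the left
   side term by term. *)
rewrite (big_ord_widen n.+1 (fun l => a k * (b l * c (n - k - l)%N)));
  last by rewrite ltnS leq_subr.
rewrite [RHS]big_mkcond; apply: eq_bigr => l _; rewrite ltnS leq_subRL //.
(* If [k + l] exceeds [n], no [m] qualifies; otherwise [m = n - (k + l)] is the only one. *)
case: leqP => [le_kln | lt_nkl]; last first.
  rewrite big1 // => m /eqP klm.
  by have := leq_addr m (k + l); rewrite klm leqNgt lt_nkl.
rewrite (big_pred1 (inord (n - (k + l)))) => [|m].
  by rewrite inordK ?ltnS ?leq_subr // subnDA mulrA.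
rewrite /= -val_eqE /= inordK ?ltnS ?leq_subr //.
by rewrite -[RHS](eqn_add2l (k + l)) subnKC.
Qed.

End FormalSeriesProduct.

(** The Euclidean division in [trinomial] is exact: the quotient is ['C(n, k) * 'C(n - k, l)]. *)
Lemma trinomial_fact n k l m : (k + l + m)%N = n ->
  (trinomial n k l m * (k`! * l`! * m`!))%N = n`!.
Proof.
move=> klm; rewrite /trinomial divnK //; apply/dvdnP.
exists ('C(n, k) * 'C(n - k, l))%N.
have le_kn : (k <= n)%N by rewrite -klm -addnA leq_addr.
have nkE : (n - k = l + m)%N by rewrite -klm -addnA addKn.
have le_ln : (l <= n - k)%N by rewrite nkE leq_addr.
rewrite -(bin_fact le_kn) -(bin_fact le_ln) nkE addKn.
by rewrite -!mulnA; congr (_ * _)%N; rewrite mulnCA.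
Qed.

Section QBernoulliProduct.
Variables (R : realType) (p : nat) (F : padic_complex R p).
Implicit Types Q w x : Cp F.

Definition scaled_qbernoulli_gf Q w : nat -> Cp F :=
  fun i => qbernoulli_gf Q i * w ^+ i.

Lemma qbernoulli_scale n Q w x :
  qbernoulli n Q x * w ^+ n =
  n`!%:R * fps_mul (scaled_qbernoulli_gf Q w) (fps_exp (w * x)) n.
Proof.
rewrite /qbernoulli -mulrA fps_mul_scale; congr (_ * fps_mul _ _ _).
by apply/funext => i; exact: fps_exp_scale.
Qed.

Lemma sum_trinomial_qbernoulli n Q1 Q2 Q3 x1 x2 x3 w1 w2 w3 :
  \sum_(k < n.+1) \sum_(l < n.+1) \sum_(m < n.+1 | (k + l + m)%N == n)
    (trinomial n k l m)%:R
    * qbernoulli k Q1 x1 * qbernoulli l Q2 x2 * qbernoulli m Q3 x3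
    * w1 ^+ k * w2 ^+ l * w3 ^+ m
  = n`!%:R *
    fps_mul (fps_mul (scaled_qbernoulli_gf Q1 w1) (fps_exp (w1 * x1)))
      (fps_mul (fps_mul (scaled_qbernoulli_gf Q2 w2) (fps_exp (w2 * x2)))
        (fps_mul (scaled_qbernoulli_gf Q3 w3) (fps_exp (w3 * x3)))) n.
Proof.
rewrite -sum_trinomial_fps_mul mulr_sumr; apply: eq_bigr => k _.
rewrite mulr_sumr; apply: eq_bigr => l _.
rewrite mulr_sumr; apply: eq_bigr => m /eqP klm.
transitivity ((trinomial n k l m)%:R * (qbernoulli k Q1 x1 * w1 ^+ k)
    * (qbernoulli l Q2 x2 * w2 ^+ l) * (qbernoulli m Q3 x3 * w3 ^+ m)).
  by ring.
by rewrite !qbernoulli_scale -(trinomial_fact klm) !natrM; ring.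
Qed.

End QBernoulliProduct.

Theorem theorem4p16 (R : realType) (p : nat) (p_prime : prime p)
    (F : padic_complex R p)
    (q : Cp F) (q_neq1 : q <> 1)
    (q_near1 : Cp_abs (q - 1) < p%:R `^ (- (p%:R - 1)^-1))
    (w1 w2 w3 : nat) (w1_gt0 : (0 < w1)%N) (w2_gt0 : (0 < w2)%N)
    (w3_gt0 : (0 < w3)%N)
    (n : nat) (y : Cp F) (y_Zp : padic_int y) :
  \sum_(k < n.+1) \sum_(l < n.+1) \sum_(m < n.+1 | (k + l + m)%N == n)
    (trinomial n k l m)%:R
    * qbernoulli k (q ^+ w3) (w1%:R * y)
    * qbernoulli l (q ^+ w1) (w2%:R * y)
    * qbernoulli m (q ^+ w2) (w3%:R * y)
    * w3%:R ^+ k * w1%:R ^+ l * w2%:R ^+ m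
  = \sum_(k < n.+1) \sum_(l < n.+1) \sum_(m < n.+1 | (k + l + m)%N == n)
    (trinomial n k l m)%:R
    * qbernoulli k (q ^+ w2) (w1%:R * y)
    * qbernoulli l (q ^+ w1) (w3%:R * y)
    * qbernoulli m (q ^+ w3) (w2%:R * y)
    * w2%:R ^+ k * w1%:R ^+ l * w3%:R ^+ m.
Proof.
rewrite !sum_trinomial_qbernoulli; congr (_ * _).
set A1 := scaled_qbernoulli_gf (q ^+ w1) _.
set A2 := scaled_qbernoulli_gf (q ^+ w2) _.
set A3 := scaled_qbernoulli_gf (q ^+ w3) _.
(* The six exponents on the two sides become three, each shared by both sides. *)
rewrite (mulrCA w3%:R w1%:R) (mulrCA w1%:R w2%:R) (mulrCA w2%:R w3%:R).
set E13 := fps_exp (w1%:R * (w3%:R * y)).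
set E21 := fps_exp (w2%:R * (w1%:R * y)).
set E32 := fps_exp (w3%:R * (w2%:R * y)).
have mulCA (a b c : nat -> Cp F) :
    fps_mul a (fps_mul b c) = fps_mul b (fps_mul a c).
  by rewrite !fps_mulA (fps_mulC a).
rewrite -!fps_mulA.
(* Both products are sorted into the order [A2], [A3], [A1], [E21], [E13], [E32]; the last factor is
   already in place on each side. *)
rewrite (mulCA E21 A2) (mulCA A1 A2) (mulCA E13 A2) (mulCA A3 A2).
rewrite (mulCA E13 A3) (mulCA A1 A3) (mulCA E21 A3).
by rewrite (mulCA E13 A1) (mulCA E13 E21) (mulCA E21 A1).
Qed.
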